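(* Let $\alpha\in\{1,2,3\}$. In the GEMPIF method, the exact solution $\varphi_{\tau,v_\alpha}:\mathsf U^0\mapsto\mathsf U(\tau)$, $\tau\ne0$, of the kinetic split step in direction $\alpha$ (the ODE system given in the context, with initial data marked by a superscript $0$) is given explicitly, for all $p\in\{1,\dots,N\}$, $\boldsymbol k\in\{-K,\dots,K\}^3$ and $\nu=\pm1$, by $$\begin{aligned} X_{p,\alpha}(\tau)&=X^0_{p,\alpha}+\tau V_{p,\alpha},\qquad X_{p,\alpha+\nu}(\tau)=X^0_{p,\alpha+\nu},\qquad V_{p,\alpha}(\tau)=V^0_{p,\alpha},\\ V_{p,\alpha+\nu}(\tau)&=V^0_{p,\alpha+\nu}-\nu\tau\frac{q_p}{m_p}L^3\sum_{\boldsymbol k\in\{-K,\dots,K\}^3}B_{\alpha-\nu,\boldsymbol k}\,\overline{\big(\gamma_{\boldsymbol k}\mathcal F_{\boldsymbol k}(S)\hat V_{p,\alpha,\boldsymbol k}(\tau)\big)},\\ E_{\alpha,\boldsymbol k}(\tau)&=E^0_{\alpha,\boldsymbol k}-\tau\gamma_{\boldsymbol k}\mathcal F_{\boldsymbol k}(S)\sum_{p=1}^Nq_p\hat V_{p,\alpha,\boldsymbol k}(\tau),\\ E_{\alpha+\nu,\boldsymbol k}(\tau)&=E^0_{\alpha+\nu,\boldsymbol k},\qquad \boldsymbol B_K(\tau)=\boldsymbol B_K^0, \end{aligned}$$ where $$\hat V_{p,\alpha,\boldsymbol k}(\tau)=\begin{cases}V_{p,\alpha}\,e^{-\frac{2i\pi\boldsymbol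 k\cdot\boldsymbol X_p^0}L}&\text{if }k_\alpha=0,\\[4pt]\Big(-\dfrac{2i\pi k_\alpha\tau}L\Big)^{-1}\Big(e^{-\frac{2i\pi k_\alpha\tau V_{p,\alpha}}L}-1\Big)e^{-\frac{2i\pi\boldsymbol k\cdot\boldsymbol X_p^0}L}&\text{if }k_\alpha\neq0.\end{cases}$$
   Context: Fix $L>0$, integers $K\ge0$, $N\ge1$, charges $q_p\in\mathbb R$, masses $m_p>0$. Dimension indices are circular: $\alpha\equiv\alpha+3$. The shape $S$ is a real-valued distribution on $\mathbb R^3$, $L$-periodic in each variable (e.g. a periodic Dirac mass); $S_{\boldsymbol y}=S(\cdot-\boldsymbol y)$. The Fourier coefficients are $\mathcal F_{\boldsymbol k}(G)=L^{-3}\int_{[0,L]^3}G(\boldsymbol x)e^{-2i\pi\boldsymbol k\cdot\boldsymbol x/L}d\boldsymbol x$ (in the distribution sense if needed), so that $\mathcal F_{\boldsymbol k}(S_{\boldsymbol y})=\mathcal F_{\boldsymbol k}(S)e^{-2i\pi\boldsymbol k\cdot\boldsymbol y/L}$. Let $\gamma_{\boldsymbol k}=\overline{\gamma_{-\boldsymbol k}}\in\mathbb C$ be Hermitian filter coefficients. In the GEMPIF method the particle-field coupling operators are the filtered $L^2$ projections, whose coefficients are $$(\Pi^1_\alpha S_{\boldsymbol y})_{\boldsymbol k}=(\Pi^2_\alpha S_{\boldsymbol y})_{\boldsymbol k}=\gamma_{\boldsymbol k}\mathcal F_{\boldsymbol k}(S_{\boldsymbol y}),\qquad\boldsymbol k\in\{-K,\dots,K\}^3,\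 \alpha=1,2,3.$$ The state $\mathsf U$ consists of particle positions $\boldsymbol X_p=(X_{p,\alpha})_\alpha\in\mathbb R^3$, velocities $\boldsymbol V_p=(V_{p,\alpha})_\alpha\in\mathbb R^3$, and the Fourier coefficients $\boldsymbol E_{\boldsymbol k}=(E_{\alpha,\boldsymbol k})_\alpha$, $\boldsymbol B_{\boldsymbol k}=(B_{\alpha,\boldsymbol k})_\alpha\in\mathbb C^3$, $\boldsymbol k\in\{-K,\dots,K\}^3$, of real-valued fields $\boldsymbol E_K=\sum_{\boldsymbol k}\boldsymbol E_{\boldsymbol k}e^{2i\pi\boldsymbol k\cdot\boldsymbol x/L}$, $\boldsymbol B_K=\sum_{\boldsymbol k}\boldsymbol B_{\boldsymbol k}e^{2i\pi\boldsymbol k\cdot\boldsymbol x/L}$ (Hermitian coefficients). The kinetic split step in direction $\alpha$ is the ODE system, for all $p$, $\boldsymbol k$ and $\nu=\pm1$, $$\begin{aligned} &\tfrac d{dt}X_{p,\alpha}=V_{p,\alpha},\quad\tfrac d{dt}X_{p,\alpha+\nu}=0,\quad\tfrac d{dt}V_{p,\alpha}=0,\\ &\tfrac d{dt}V_{p,\alpha+\nu}=-\nu\frac{q_p}{m_p}L^3\sum_{\boldsymbol k}V_{p,\alpha}B_{\alpha-\nu,\boldsymbol k}\overline{(\Pi^1_{\alpha-\nu}S_{\boldsymbol X_p})_{\boldsymbol k}},\\ &\tfrac d{dt}E_{\alpha,\boldsymbol k}=-\sum_pq_pV_{p,\alpha}(\Pi^2_\alpha S_{\boldsymbol X_p})_{\boldsymbol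 k},\quad\tfrac d{dt}E_{\alpha+\nu,\boldsymbol k}=0,\quad\tfrac d{dt}\boldsymbol B_{\boldsymbol k}=0. \end{aligned}$$ In the claim, $V_{p,\alpha}$ and $B_{\alpha-\nu,\boldsymbol k}$ without time argument denote the (constant) values $V_{p,\alpha}^0$ and $B_{\alpha-\nu,\boldsymbol k}^0$. *)

(* Defs.v *)
From HB Require Import structures.
From mathcomp Require Import all_boot all_order all_algebra.
From mathcomp Require Import complex zify.
From mathcomp Require Import boolp classical_sets functions fsbigop reals.
From mathcomp Require Import topology normedtype derive trigo.

Set Implicit Arguments.
Unset Strict Implicit.
Unset Printing Implicit Defensive.

Import Order.TTheory GRing.Theory Num.Theory.
Import numFieldNormedType.Exports.

Local Open Scope classical_set_scope.
Local Open Scope ring_scope.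

Section Distributions.
Context {R : realType}.

(* The index type 'I_3 carries the ring structure of Z/3Z, so that addition of
   dimension indices is circular. *)
Notation space := 'rV[R]_3.

Definition basis_vec (i : 'I_3) : space := delta_mx 0 i.

Definition partial (s : seq 'I_3) (phi : space -> R) : space -> R :=
  foldr (fun i psi x => 'D_(basis_vec i) psi x) phi s.

Definition smooth (phi : space -> R) : Prop :=
  forall s : seq 'I_3, continuous (partial s phi) /\
    forall (i : 'I_3) (x : space), derivable (partial s phi) x (basis_vec i).

Definition vanishes_outside (A : set space) (phi : space -> R) : Prop :=
  forall x, ~ A x -> phi x = 0.

Definition test_function (phi : space -> R) : Prop :=
  smooth phi /\ exists2 A, compact A & vanishes_outside A phi.

(* A real-valued distribution is a functional on real test functions; its values
   on functions that are not test functions are irrelevant.  The second clause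
   is the usual seminorm estimate on each compact set, M standing for an upper
   bound of the derivatives of order at most n. *)
Definition is_distribution (T : (space -> R) -> R) : Prop :=
  (forall (a : R) (phi psi : space -> R),
     test_function phi -> test_function psi ->
     T (fun x => a * phi x + psi x) = a * T phi + T psi) /\
  (forall A : set space, compact A ->
     exists (C : R) (n : nat), forall (phi : space -> R) (M : R),
       test_function phi -> vanishes_outside A phi ->
       (forall s x, (size s <= n)%N -> `|partial s phi x| <= M) ->
       `|T phi| <= C * M).

(* G(. - y), by duality *)
Definition translate (y : space) (T : (space -> R) -> R) : (space -> R) -> R :=
  fun phi => T (fun x => phi (x + y)).

Definition distr_periodic (L : R) (T : (space -> R) -> R) : Prop :=
  forall (i : 'I_3) (phi : space -> R), test_function phi ->
    translate (L *: basis_vec i) T phi = T phi.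

Definition pairing (T : (space -> R) -> R) (f : space -> R[i]) : R[i] :=
  (T (fun x => complex.Re (f x)) +i* T (fun x => complex.Im (f x)))%C.

Definition expi (t : R) : R[i] := (cos t +i* sin t)%C.

Definition dotp (k : 'rV[int]_3) (x : space) : R :=
  \sum_(i < 3) (k 0 i)%:~R * x 0 i.

Definition phase (L : R) (k : 'rV[int]_3) (x : space) : R :=
  2 * pi * dotp k x / L.

(* The integral over a period of an L-periodic distribution is its pairing with
   any test function whose translates by the lattice L Z^3 sum to 1; such a
   function exists when L > 0, and the result does not depend on its choice. *)
Definition is_period_cutoff (L : R) (theta : space -> R) : Prop :=
  test_function theta /\
  forall x : space,
    \sum_(n \in [set: 'rV[int]_3]) theta (x + L *: map_mx intr n) = 1.

Definition period_cutoff (L : R) : space -> R :=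
  xget (fun=> 0) [set theta | is_period_cutoff L theta].

Definition period_pairing (L : R) (T : (space -> R) -> R) (f : space -> R[i]) :
    R[i] :=
  pairing T (fun x => (period_cutoff L x)%:C%C * f x).

Definition fourier (L : R) (k : 'rV[int]_3) (T : (space -> R) -> R) : R[i] :=
  (L ^- 3)%:C%C * period_pairing L T (fun x => expi (- phase L k x)).

End Distributions.

(* Modes encode {-K, ..., K}^3: the offset index k i in {0, ..., 2K} stands for
   the wave number k i - K. *)
Definition mode (K : nat) := {ffun 'I_3 -> 'I_(2 * K).+1}.

Definition freq (K : nat) (k : mode K) : 'rV[int]_3 :=
  \row_i ((k i)%:Z - K%:Z).

Definition mode_opp (K : nat) (k : mode K) : mode K := [ffun i => rev_ord (k i)].

Lemma freq_opp (K : nat) (k : mode K) : freq (mode_opp k) = - freq k.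
Proof.
apply/rowP => i; rewrite !mxE ffunE /=.
by have := ltn_ord (k i); set a := nat_of_ord (k i); lia.
Qed.

Definition hermitian_coef (R : realType) (K : nat) (c : mode K -> R[i]) : Prop :=
  forall k, c k = ((c (mode_opp k))^*)%C.

Definition trig_field (R : realType) (L : R) (K : nat) (c : mode K -> R[i])
    (x : 'rV[R]_3) : R[i] :=
  \sum_(k : mode K) c k * expi (phase L (freq k) x).

Record state (R : realType) (K N : nat) := State {
  pos : 'I_N -> 'rV[R]_3;
  vel : 'I_N -> 'rV[R]_3;
  Efield : 'I_3 -> mode K -> R[i];
  Bfield : 'I_3 -> mode K -> R[i]
}.

Definition real_fields (R : realType) (K N : nat) (U : state R K N) : Prop :=
  forall i, hermitian_coef (Efield U i) /\ hermitian_coef (Bfield U i).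

(* dz/dt (t) = d for a complex-valued function z of a real variable *)
Definition is_cderive (R : realType) (z : R -> R[i]) (t : R) (d : R[i]) : Prop :=
  is_derive t (1 : R) (fun s => complex.Re (z s)) (complex.Re d) /\
  is_derive t (1 : R) (fun s => complex.Im (z s)) (complex.Im d).

(* Coefficients, on modes, of the projections of a distribution; the first
   argument is the direction. *)
Definition coupling (R : realType) (K : nat) :=
  'I_3 -> (('rV[R]_3 -> R) -> R) -> mode K -> R[i].

Definition gempif_coupling (R : realType) (L : R) (K : nat)
    (gamma : mode K -> R[i]) : coupling R K :=
  fun _ T k => gamma k * fourier L (freq k) T.

(* The particle velocity and its derivative are real; the equation for
   d/dt V_(alpha + nu) is read in R[i], its right-hand side being a sum of
   complex terms. *)
Record kinetic_ode (R : realType) (L : R) (K N : nat) (q m : 'I_N -> R)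
    (S : ('rV[R]_3 -> R) -> R) (Pi1 Pi2 : coupling R K) (alpha : 'I_3)
    (U : R -> state R K N) (t : R) : Prop := KineticOde {
  ode_pos : forall p,
    is_derive t (1 : R) (fun s => pos (U s) p 0 alpha) (vel (U t) p 0 alpha);
  ode_pos_trans : forall p (nu : int), nu = 1 \/ nu = -1 ->
    is_derive t (1 : R) (fun s => pos (U s) p 0 (alpha + nu%:~R)) 0;
  ode_vel : forall p,
    is_derive t (1 : R) (fun s => vel (U s) p 0 alpha) 0;
  ode_vel_trans : forall p (nu : int), nu = 1 \/ nu = -1 ->
    is_cderive (fun s => (vel (U s) p 0 (alpha + nu%:~R))%:C%C) t
      (- (nu%:~R * (q p / m p) * L ^+ 3)%:C%C *
       \sum_(k : mode K) (vel (U t) p 0 alpha)%:C%C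
         * Bfield (U t) (alpha - nu%:~R) k
         * ((Pi1 (alpha - nu%:~R) (translate (pos (U t) p) S) k)^*)%C);
  ode_E : forall k,
    is_cderive (fun s => Efield (U s) alpha k) t
      (- \sum_(p < N) (q p * vel (U t) p 0 alpha)%:C%C
           * Pi2 alpha (translate (pos (U t) p) S) k);
  ode_E_trans : forall k (nu : int), nu = 1 \/ nu = -1 ->
    is_cderive (fun s => Efield (U s) (alpha + nu%:~R) k) t 0;
  ode_B : forall i k, is_cderive (fun s => Bfield (U s) i k) t 0
}.

(* U1 is the value at time tau of an exact solution issued from U0. *)
Definition kinetic_flow (R : realType) (L : R) (K N : nat) (q m : 'I_N -> R)
    (S : ('rV[R]_3 -> R) -> R) (Pi1 Pi2 : coupling R K) (alpha : 'I_3)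
    (tau : R) (U0 U1 : state R K N) : Prop :=
  exists U : R -> state R K N,
    [/\ U 0 = U0, (forall t, real_fields (U t)),
        (forall t, kinetic_ode L q m S Pi1 Pi2 alpha U t) & U tau = U1].

Definition Vhat (R : realType) (L : R) (K N : nat) (alpha : 'I_3) (tau : R)
    (U0 : state R K N) (p : 'I_N) (k : mode K) : R[i] :=
  let ka : R := (freq k 0 alpha)%:~R in
  let v := vel U0 p 0 alpha in
  let e0 := expi (- phase L (freq k) (pos U0 p)) in
  if freq k 0 alpha == 0 then v%:C%C * e0
  else (- ('i%C * (2 * pi * ka * tau / L)%:C%C))^-1
       * (expi (- (2 * pi * ka * tau * v / L)) - 1) * e0.

(* Main.v *)
(* Along the step the velocity and the magnetic field in the coupled direction
   are frozen, so each particle moves on a line and t * Vhat(t) is the integral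
   over [0, t] of V exp(-2 i pi k.X(s) / L).  Everything then reduces to
   F_k(S_y) = F_k(S) exp(-2 i pi k.y / L): after a change of variables this says
   that F_k(S) does not depend on the period cutoff, which is seen by inserting
   the partition of unity of one cutoff into the pairing with the other and
   moving the lattice translations across by periodicity.  Uniqueness holds since
   two functions with the same derivative and the same value at 0 agree. *)

Require Import Defs.
From mathcomp Require Import all_boot all_order all_algebra.
From mathcomp Require Import complex.
From mathcomp Require Import boolp classical_sets reals topology normedtype derive trigo.
From mathcomp Require Import functions fsbigop realfun ring zify.

Set Implicit Arguments.
Unset Strict Implicit.
Unset Printing Implicit Defensive.

Import Order.TTheory GRing.Theory Num.Theory.
Import numFieldNormedType.Exports.

Local Open Scope ring_scope.

(** * Smooth functions: a coinduction principle and closure properties *)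

(** Stability of [P] under partial derivatives carries [P] to every iterated derivative, so only one
    order of differentiation ever has to be examined. Smoothness proofs then reduce to choosing a
    stable class. *)
Lemma smooth_coind (R : realType) (P : ('rV[R]_3 -> R) -> Prop) :
  (forall f, P f -> continuous f /\ forall i,
     (forall x, derivable f x (basis_vec i)) /\ P (fun x => 'D_(basis_vec i) f x)) ->
  forall f, P f -> smooth f.
Proof.
move=> Pstep f Pf s.
have /Pstep[cf df] : P (partial s f).
  by elim: s => [//|i s /Pstep[_ /(_ i)[]]].
by split=> [|i x]; [|case: (df i)].
Qed.

Lemma smooth_derive (R : realType) (f : 'rV[R]_3 -> R) (i : 'I_3) :
  smooth f -> smooth (fun x => 'D_(basis_vec i) f x).
Proof.
(* The head of the list is the outermost derivative in [partial], so the derivative taken first sits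
   at the end of the list. *)
move=> sf s; have := sf (rcons s i).
by rewrite /partial foldr_rcons.
Qed.

(* This class is stable under partial derivatives by the Leibniz rule, hence all
   its members are smooth. *)
Inductive smooth_closure (R : realType) : ('rV[R]_3 -> R) -> Prop :=
| Closure_smooth f : smooth f -> smooth_closure f
| Closure_add f g : smooth_closure f -> smooth_closure g -> smooth_closure (f + g)
| Closure_mul f g : smooth_closure f -> smooth_closure g -> smooth_closure (f * g).

Lemma smooth_closure_smooth (R : realType) (f : 'rV[R]_3 -> R) :
  smooth_closure f -> smooth f.
Proof.
apply: smooth_coind => {}f.
elim=> {f}[f sf|f g cf [ctf df] cg [ctg dg]|f g cf [ctf df] cg [ctg dg]].
- split=> [|i]; first by case: (sf [::]).
  by split=> [x|]; [case: (sf [::]) | apply/Closure_smooth/smooth_derive].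
- split=> [x|i]; first exact: (continuousD (ctf x) (ctg x)).
  have [dfi cdf] := df i; have [dgi cdg] := dg i.
  split=> [x|]; first exact: derivableD.
  rewrite (_ : (fun x => _) =
    (fun x => 'D_(basis_vec i) f x) + (fun x => 'D_(basis_vec i) g x)).
    exact: Closure_add.
  by apply/funext => x; rewrite deriveD.
- split=> [x|i]; first exact: (continuousM (ctf x) (ctg x)).
  have [dfi cdf] := df i; have [dgi cdg] := dg i.
  split=> [x|]; first exact: derivableM.
  rewrite (_ : (fun x => _) =
    f * (fun x => 'D_(basis_vec i) g x) + g * (fun x => 'D_(basis_vec i) f x)).
    by apply: Closure_add; apply: Closure_mul.
  by apply/funext => x; rewrite deriveM.
Qed.

Lemma smoothD (R : realType) (f g : 'rV[R]_3 -> R) :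
  smooth f -> smooth g -> smooth (f + g).
Proof.
by move=> sf sg; apply/smooth_closure_smooth/Closure_add; apply: Closure_smooth.
Qed.

Lemma smoothM (R : realType) (f g : 'rV[R]_3 -> R) :
  smooth f -> smooth g -> smooth (f * g).
Proof.
by move=> sf sg; apply/smooth_closure_smooth/Closure_mul; apply: Closure_smooth.
Qed.

Lemma smooth_cst (R : realType) (c : R) : smooth (fun=> c : R).
Proof.
(* The class must contain all constants, since the derivative of [c] is the constant 0. *)
apply: (@smooth_coind _ (fun f => exists c, f = cst c)); last by exists c.
move=> _ [{}c ->]; split=> [|i]; first exact: cst_continuous.
split=> [x|]; first exact: derivable_cst.
by exists 0; apply/funext => x; rewrite derive_cst.
Qed.

(** * Phases and real trigonometric waves *)

Lemma phaseD (R : realType) (L : R) (k : 'rV[int]_3) (x y : 'rV[R]_3) :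
  phase L k (x + y) = phase L k x + phase L k y.
Proof.
rewrite /phase /dotp -mulrDl -mulrDr -big_split /=; congr (_ * _ / _).
by apply: eq_bigr => i _; rewrite mxE mulrDr.
Qed.

Lemma phaseZ (R : realType) (L a : R) (k : 'rV[int]_3) (x : 'rV[R]_3) :
  phase L k (a *: x) = a * phase L k x.
Proof.
rewrite /phase /dotp (_ : \sum_(i < 3) _ = a * \sum_(i < 3) (k 0 i)%:~R * x 0 i).
  by ring.
by rewrite mulr_sumr; apply: eq_bigr => i _; rewrite mxE mulrCA.
Qed.

Lemma phaseN (R : realType) (L : R) (k : 'rV[int]_3) (x : 'rV[R]_3) :
  phase L (- k) x = - phase L k x.
Proof.
rewrite /phase /dotp (_ : \sum_(i < 3) _ = - \sum_(i < 3) (k 0 i)%:~R * x 0 i).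
  by ring.
by rewrite -sumrN; apply: eq_bigr => i _; rewrite mxE mulrNz mulNr.
Qed.

Lemma phase_basis (R : realType) (L : R) (k : 'rV[int]_3) (i : 'I_3) :
  phase L k (basis_vec i) = 2 * pi * (k 0 i)%:~R / L.
Proof.
rewrite /phase /dotp (bigD1 i) //= mxE !eqxx mulr1 big1 ?addr0 // => j ji.
by rewrite mxE eqxx (negbTE ji) mulr0.
Qed.

Lemma phase_continuous (R : realType) (L : R) (k : 'rV[int]_3) :
  continuous (phase L k : 'rV[R]_3 -> R).
Proof.
have cdot : continuous (fun x : 'rV[R]_3 => \sum_(i < 3) (k 0 i)%:~R * x 0 i).
  apply: (@continuous_big _ _ +%R) => [|i _ x]; first exact: add_continuous.
  have ci := @coord_continuous R 1 3 0 i x.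
  exact: (continuousM (@cst_continuous _ R (k 0 i)%:~R x) ci).
move=> x.
exact: (continuousM (continuousM (@cst_continuous _ R (2 * pi) x) (cdot x))
                    (@cst_continuous _ R L^-1 x)).
Qed.

(** The phase is linear, so the restriction to a line in direction [basis_vec i] is [h] composed
    with an affine function of one variable, and the one-variable chain rule at 0 applies. *)
Lemma is_derive_comp_phase (R : realType) (L : R) (k : 'rV[int]_3) (i : 'I_3)
    (h : R -> R) (x : 'rV[R]_3) (d : R) :
  is_derive (phase L k x) (1 : R) h d ->
  is_derive x (basis_vec i) (fun y => h (phase L k y)) (d * phase L k (basis_vec i)).
Proof.
move=> dh; set b := phase L k (basis_vec i).
have line (y : R) : h (phase L k (y *: basis_vec i + x)) = h (y * b + phase L k x).
  by rewrite phaseD phaseZ.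
have dline : is_derive (0 : R) (1 : R) (fun y => h (y * b + phase L k x)) (d * b).
  have db : is_derive (0 : R) (1 : R) (fun y : R => y * b + phase L k x) b.
    by apply: is_derive_eq; rewrite /GRing.scale/= !(mulr0, add0r, addr0, mulr1).
  have := @is_derive1_comp _ h _ 0 d b _ db.
  by rewrite mul0r add0r mulrC; apply.
(* The two difference quotients are the same function, so both derivability and the value of the
   derivative transfer. *)
have E : (fun y : R => y^-1 *:
    ((fun z => h (phase L k z)) (y *: basis_vec i + x) - h (phase L k x))) =
  (fun y : R => y^-1 *: ((fun y => h (y * b + phase L k x)) (y *: (1 : R) + 0)
    - h (0 * b + phase L k x))).
  by apply/funext => y; rewrite line mul0r add0r addr0 /GRing.scale/= mulr1.
case: dline => dv vE; split.
  by rewrite /derivable /= E.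
by rewrite /derive /= E.
Qed.

(** Distributions act on real functions, so exponentials are handled through real waves: the
    coefficients (1, 0) and (0, -1) give the real and imaginary parts of exp(-i phase). Keeping both
    coefficients free makes the family stable under differentiation and translation. *)
Definition trig_wave {R : realType} (L : R) (k : 'rV[int]_3) (a b : R)
    (x : 'rV[R]_3) : R :=
  a * cos (phase L k x) + b * sin (phase L k x).

Lemma smooth_trig_wave (R : realType) (L : R) (k : 'rV[int]_3) (a b : R) :
  smooth (trig_wave L k a b : 'rV[R]_3 -> R).
Proof.
apply: (@smooth_coind _ (fun f => exists a b, f = trig_wave L k a b)); last first.
  by exists a, b.
move=> _ [{}a [{}b ->]]; split=> [x|i].
  have cc := continuous_comp (@phase_continuous _ L k x) (@continuous_cos _ _).
  have cs := continuous_comp (@phase_continuous _ L k x) (@continuous_sin _ _).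
  exact: (continuousD (continuousM (@cst_continuous _ R a x) cc)
                      (continuousM (@cst_continuous _ R b x) cs)).
set c := phase L k (basis_vec i).
have D x : is_derive x (basis_vec i) (trig_wave L k a b)
    (* Differentiation sends the coefficients (a, b) to (bc, -ac), which keeps the class stable. *)
    (trig_wave L k (b * c) (- a * c) x).
  pose h := (fun t : R => a * cos t + b * sin t).
  have dh : is_derive (phase L k x) (1 : R) h
      (- a * sin (phase L k x) + b * cos (phase L k x)).
    apply: is_derive_eq; rewrite /GRing.scale /=; ring.
  have -> : trig_wave L k (b * c) (- a * c) x =
      (- a * sin (phase L k x) + b * cos (phase L k x)) * c.
    by rewrite /trig_wave; ring.
  exact: (is_derive_comp_phase i dh).
split=> [x|]; first by case: (D x).
by exists (b * c), (- a * c); apply/funext => x; case: (D x).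
Qed.

Lemma partial_translate (R : realType) (s : seq 'I_3) (f : 'rV[R]_3 -> R)
    (y : 'rV[R]_3) :
  partial s (fun x => f (x + y)) = fun x => partial s f (x + y).
Proof.
elim: s => //= i s ->; apply/funext => x.
by rewrite /derive /= (_ : (fun h => _) = fun h : R =>
  h^-1 *: (partial s f (h *: basis_vec i + (x + y)) - partial s f (x + y))) //;
  apply/funext => h; rewrite addrA.
Qed.

Lemma smooth_translate (R : realType) (f : 'rV[R]_3 -> R) (y : 'rV[R]_3) :
  smooth f -> smooth (fun x => f (x + y)).
Proof.
move=> sf s; have [cf df] := sf s; rewrite partial_translate; split=> [x|i x].
  have cs : {for x, continuous (fun z : 'rV[R]_3 => z + y)}.
    exact: (@continuousD _ _ _ id (fun=> y) x cvg_id (@cst_continuous _ _ y x)).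
  exact: (continuous_comp cs (cf _)).
have := df i (x + y); rewrite /derivable /=.
rewrite (_ : (fun h => _) = fun h : R =>
  h^-1 *: (partial s f (h *: basis_vec i + (x + y)) - partial s f (x + y))) //.
by move=> H; rewrite (_ : (fun h => _) = fun h : R =>
  h^-1 *: (partial s f (h *: basis_vec i + (x + y)) - partial s f (x + y))) //;
  apply/funext => h; rewrite addrA.
Qed.

(** * Test functions, periodic distributions and independence of the period cutoff *)

Section TestFunctions.
Context {R : realType}.
Implicit Types (phi psi theta f : 'rV[R]_3 -> R) (T : ('rV[R]_3 -> R) -> R).

Lemma test_functionD phi psi :
  test_function phi -> test_function psi -> test_function (phi + psi).
Proof.
move=> [sphi [A cA A0]] [spsi [B cB B0]]; split; first exact: smoothD.
exists (A `|` B)%classic; first exact: compactU.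
move=> x /not_orP[nA nB]; rewrite [LHS]/GRing.add /=.
by rewrite A0 // B0 // addr0.
Qed.

Lemma test_functionMr phi f :
  test_function phi -> smooth f -> test_function (phi * f).
Proof.
move=> [sphi [A cA A0]] sf; split; first exact: smoothM.
by exists A => // x nA; rewrite [LHS]/GRing.mul /= A0 // mul0r.
Qed.

Lemma test_function_translate phi (y : 'rV[R]_3) :
  test_function phi -> test_function (fun x => phi (x + y)).
Proof.
move=> [sphi [A cA A0]]; split; first exact: smooth_translate.
exists [set x - y | x in A]%classic.
  apply: (@continuous_compact _ _ (fun x : 'rV[R]_3 => x - y)) => //.
  apply: continuous_subspaceT => x.
  exact: (@continuousD _ _ _ id (fun=> - y) x cvg_id (@cst_continuous _ _ (- y) x)).
by move=> x nA; apply: A0 => Axy; apply: nA; exists (x + y); rewrite ?addrK.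
Qed.

Lemma test_function0 : test_function (0 : 'rV[R]_3 -> R).
Proof.
split; first exact: smooth_cst.
by exists set0 => //; exact: compact0.
Qed.

Lemma test_function_sum (I : Type) (s : seq I) (F : I -> 'rV[R]_3 -> R) :
  (forall i, test_function (F i)) -> test_function (\sum_(i <- s) F i).
Proof.
move=> tF; elim/big_ind: _ => //; first exact: test_function0.
exact: test_functionD.
Qed.

Lemma distrD T phi psi :
  is_distribution T -> test_function phi -> test_function psi ->
  T (phi + psi) = T phi + T psi.
Proof.
move=> [lin _] tphi tpsi; rewrite -[T phi]mul1r -lin //.
by congr (T _); apply/funext => x; rewrite mul1r.
Qed.

Lemma distr0 T : is_distribution T -> T 0 = 0.
Proof.
move=> dT; have := distrD dT test_function0 test_function0.
by rewrite addr0 => /eqP; rewrite -subr_eq0 opprD addrA subrr sub0r oppr_eq0 => /eqP.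
Qed.

Lemma distrZ T (a : R) phi : is_distribution T -> test_function phi ->
  T (fun x => a * phi x) = a * T phi.
Proof.
move=> dT tphi; have := dT.1 a _ _ tphi test_function0.
by rewrite distr0 // addr0 => <-; congr (T _); apply/funext => x; rewrite addr0.
Qed.

Lemma distr_sum T (I : Type) (s : seq I) (F : I -> 'rV[R]_3 -> R) :
  is_distribution T -> (forall i, test_function (F i)) ->
  T (\sum_(i <- s) F i) = \sum_(i <- s) T (F i).
Proof.
move=> dT tF; elim: s => [|i s IH]; first by rewrite !big_nil distr0.
by rewrite !big_cons distrD ?IH //; exact: test_function_sum.
Qed.

(** The vectors whose translation leaves [T] unchanged on all test functions form an additive group;
    it contains the three generators of the lattice. *)
Lemma distr_periodic_lattice (L : R) T (n : 'rV[int]_3) phi :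
  distr_periodic L T -> test_function phi ->
  T (fun x => phi (x + L *: map_mx intr n)) = T phi.
Proof.
move=> per.
(* The quantification over all test functions lets the property be applied to translates of the
   given one, as closure under sums and opposites requires. *)
pose G (v : 'rV[R]_3) :=
  forall phi, test_function phi -> T (fun x => phi (x + v)) = T phi.
suff : G (L *: map_mx intr n) by apply.
have G0 : G 0 by move=> psi _; congr (T _); apply/funext => x; rewrite addr0.
have GD u v : G u -> G v -> G (u + v).
  move=> Gu Gv psi tpsi; rewrite -(Gv psi) // -(Gu (fun x => psi (x + v))).
    by congr (T _); apply/funext => x; rewrite addrA.
  exact: test_function_translate.
have GN u : G u -> G (- u).
  move=> Gu psi tpsi; rewrite -(Gu (fun x => psi (x - u))).
    by congr (T _); apply/funext => x; rewrite addrK.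
  exact: test_function_translate.
have GZ u (z : int) : G u -> G (u *~ z).
  move=> Gu; have Gn m : G (u *+ m).
    by elim: m => [//|m IH]; rewrite mulrS; exact: GD.
  by case: z => m; [|apply: GN]; exact: Gn.
have -> : L *: map_mx intr n = \sum_(i < 3) (L *: basis_vec i) *~ n 0 i :> 'rV[R]_3.
  rewrite {1}(row_sum_delta (map_mx intr n)) scaler_sumr.
  apply: eq_bigr => i _; rewrite mxE scalerA mulrC -scalerA.
  by rewrite scaler_int.
by elim/big_ind: _ => // i _; apply: GZ => psi /(per i).
Qed.

Lemma mx_entry_le_norm (x : 'rV[R]_3) (i : 'I_3) : `|x 0 i| <= `|x|.
Proof.
rewrite [leRHS]/Num.norm /= mx_normrE.
by apply/bigmax_geP; right => /=; exists (0, i).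
Qed.

Lemma compact_norm_bound (A : set 'rV[R]_3) :
  compact A -> exists M, forall x, A x -> `|x| <= M.
Proof.
move=> /compact_bounded[M [_ HM]]; exists (M + 1) => x Ax.
by apply: (HM (M + 1)) => //; rewrite ltrDl.
Qed.

(** If [A] and [B] have norm bounds a and b, every entry of such an [n] is at most (a + b) / L in
    absolute value. This turns the lattice sums of cutoffs into finite sums, to which linearity
    applies. *)
Lemma lattice_translates_finite (L : R) (A B : set 'rV[R]_3) :
  0 < L -> compact A -> compact B ->
  exists2 s : seq 'rV[int]_3, uniq s &
    forall n x, A x -> B (x + L *: map_mx intr n) -> n \in s.
Proof.
move=> L0 /compact_norm_bound[a Ha] /compact_norm_bound[b Hb].
pose K := Num.bound ((a + b) / L).
(* The modes of size [K] serve here as an enumeration of the box {-K, ..., K}^3. *)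
exists (undup [seq freq k | k : mode K]) => [|n x Ax Bx]; first exact: undup_uniq.
have nK i : (absz (n 0 i)%R < K)%N.
  have : `|(L *: map_mx intr n) 0 i| <= a + b :> R.
    apply: le_trans (mx_entry_le_norm _ _) _.
    have -> : L *: map_mx intr n = (x + L *: map_mx intr n) - x.
      by rewrite addrC addKr.
    by rewrite (le_trans (ler_normB _ _)) // addrC lerD ?Ha ?Hb.
  rewrite !mxE normrM (gtr0_norm L0) -ler_pdivlMl // mulrC => le_ab.
  rewrite -(ltr_nat R); apply: le_lt_trans (archi_boundP _); last first.
    by rewrite (le_trans _ le_ab).
  by rewrite natr_absz intr_norm in le_ab *.
rewrite mem_undup; apply/mapP.
exists [ffun i => inord (absz (n 0 i + K%:Z))]; first by rewrite mem_enum.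
apply/rowP => i; rewrite !mxE ffunE inordK;
  move: (nK i); move: (n 0 i) => z; clearbody K; lia.
Qed.

(** Both pairings expand into finite sums, with terms T(theta1 f theta2(. + Ln)) and T(theta2 f
    theta1(. - Ln)). The translation by Ln, under which [f] is invariant, carries the second
    integrand to the first. *)
Lemma cutoff_indep (L : R) T theta1 theta2 f :
  0 < L -> is_distribution T -> distr_periodic L T ->
  is_period_cutoff L theta1 -> is_period_cutoff L theta2 -> smooth f ->
  (forall (n : 'rV[int]_3) x, f (x + L *: map_mx intr n) = f x) ->
  T (theta1 * f) = T (theta2 * f).
Proof.
move=> L0 dT pT [t1 s1] [t2 s2] sf pf.
have [[smooth1 [A cA A0]] [smooth2 [B cB B0]]] := (t1, t2).
have [s us Hs] := lattice_translates_finite L0 cA cB.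
have sum2 x : A x -> \sum_(n <- s) theta2 (x + L *: map_mx intr n) = 1.
  move=> Ax; rewrite -[RHS](s2 x) (fsbigE s) //.
    by apply: eq_bigl => n; rewrite in_setT.
  by move=> n _ ns; apply: B0 => Bn; rewrite (Hs n x) in ns.
(* The same list [s] works with the opposite sign: x in [B] and x - Ln in [A] also force [n] into
   [s], whence the reindexing by n -> -n. *)
have sum1 x : B x -> \sum_(n <- s) theta1 (x - L *: map_mx intr n) = 1.
  move=> Bx; rewrite -[RHS](s1 x) (fsbigE [seq - n | n <- s]) //.
  - rewrite big_map; apply: eq_big => n; first by rewrite in_setT.
    by rewrite map_mxN scalerN.
  - by rewrite map_inj_uniq //; exact: oppr_inj.
  - move=> n _ ns; apply: A0 => An; move/negP: ns; apply.
    rewrite -[n]opprK map_f // (Hs (- n) (x + L *: map_mx intr n)) //.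
    by rewrite map_mxN scalerN addrK.
pose F (n : 'rV[int]_3) := theta1 * f * (fun x => theta2 (x + L *: map_mx intr n)).
pose G (n : 'rV[int]_3) := theta2 * f * (fun x => theta1 (x - L *: map_mx intr n)).
have tF n : test_function (F n).
  apply: test_functionMr; first exact: test_functionMr.
  exact: smooth_translate.
have tG n : test_function (G n).
  apply: test_functionMr; first exact: test_functionMr.
  exact: smooth_translate.
have -> : theta1 * f = \sum_(n <- s) F n.
  rewrite -mulr_sumr; apply/funext => x.
  (* The finite sum is known to be 1 only on [A]; elsewhere [theta1] makes both sides vanish. *)
  transitivity (theta1 x * f x * \sum_(n <- s) theta2 (x + L *: map_mx intr n)).
    have [?|nA] := pselect (A x); first by rewrite sum2 // mulr1.
    by rewrite mulrfctE A0 // !mul0r.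
  by rewrite !mulrfctE fct_sumE.
have -> : theta2 * f = \sum_(n <- s) G n.
  rewrite -mulr_sumr; apply/funext => x.
  transitivity (theta2 x * f x * \sum_(n <- s) theta1 (x - L *: map_mx intr n)).
    have [?|nB] := pselect (B x); first by rewrite sum1 // mulr1.
    by rewrite mulrfctE B0 // !mul0r.
  by rewrite !mulrfctE fct_sumE.
rewrite !distr_sum //; apply: eq_bigr => n _.
rewrite -(distr_periodic_lattice n pT (tG n)); congr (T _); apply/funext => x.
by rewrite /F /G /GRing.mul /= addrK pf; ring.
Qed.

End TestFunctions.

(** * Fourier coefficients of periodic distributions *)

Section Fourier.
Context {R : realType}.
Implicit Types (L : R) (T : ('rV[R]_3 -> R) -> R).
Implicit Types (k n : 'rV[int]_3) (x y : 'rV[R]_3).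

Lemma cosD2pi_int (x : R) (z : int) : cos (x + 2 * pi * z%:~R) = cos x.
Proof.
have H (u : R) m : cos (u + 2 * pi * m%:R) = cos u.
  have -> : 2 * pi * m%:R = pi *+ 2 *+ m :> R by ring.
  exact/periodicn/cosD2pi.
case: z => m; first exact: H.
by rewrite NegzE mulrNz mulrN -[LHS](H _ m.+1) subrK.
Qed.

Lemma sinD2pi_int (x : R) (z : int) : sin (x + 2 * pi * z%:~R) = sin x.
Proof. by rewrite -!cosBpihalf addrAC cosD2pi_int. Qed.

Lemma phase_lattice L k n : L != 0 ->
  phase L k (L *: map_mx intr n) = 2 * pi * (\sum_(i < 3) k 0 i * n 0 i)%:~R.
Proof.
move=> L0; rewrite phaseZ /phase mulrC divfK //; congr (_ * _).
by rewrite /dotp rmorph_sum; apply: eq_bigr => i _; rewrite mxE rmorphM.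
Qed.

Lemma trig_wave_periodic L k (a b : R) n x : L != 0 ->
  trig_wave L k a b (x + L *: map_mx intr n) = trig_wave L k a b x.
Proof.
by move=> L0; rewrite /trig_wave phaseD phase_lattice // cosD2pi_int sinD2pi_int.
Qed.

(* When no cutoff exists, [period_cutoff] is the default value [0], all Fourier
   coefficients vanish, and the identities below hold trivially; no cutoff need
   be constructed. *)
Lemma period_cutoffP L : is_period_cutoff L (period_cutoff L) \/ period_cutoff L = 0.
Proof. by rewrite /period_cutoff; case: xgetP => [_ -> ?|_]; [left|right]. Qed.

Lemma period_cutoff_test L : test_function (period_cutoff L).
Proof. by case: (period_cutoffP L) => [[]//|->]; exact: test_function0. Qed.

Lemma is_period_cutoff_translate L theta y :
  is_period_cutoff L theta -> is_period_cutoff L (fun x => theta (x + y)).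
Proof.
move=> [ttheta sumtheta]; split; first exact: test_function_translate.
move=> x; rewrite -[RHS](sumtheta (x + y)); apply: eq_fsbigr => n _.
by rewrite addrAC.
Qed.

Lemma fourier_trig_wave L k T : fourier L k T =
  (L ^- 3)%:C%C * (T (period_cutoff L * trig_wave L k 1 0)
                   +i* T (period_cutoff L * trig_wave L k 0 (-1)))%C.
Proof.
rewrite /fourier /period_pairing /pairing; congr (_ * (T _ +i* T _)%C);
  apply/funext => x; rewrite mulrfctE /= /trig_wave ?cosN ?sinN; ring.
Qed.

(** Both [T] and the cutoff are real, so negating [k] only flips the sign of the sine wave, that is,
    of the imaginary part. *)
Lemma fourier_opp L k T : is_distribution T ->
  fourier L (- k) T = ((fourier L k T)^*)%C.
Proof.
move=> dT; rewrite !fourier_trig_wave rmorphM -[X in _ = X * _]/(conjc _) conjc_real.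
have -> : trig_wave L (- k) 1 0 = trig_wave L k 1 0.
  by apply/funext => x; rewrite /trig_wave phaseN cosN !mul0r.
have -> : trig_wave L (- k) 0 (-1) = (fun x => -1 * trig_wave L k 0 (-1) x).
  by apply/funext => x; rewrite /trig_wave phaseN sinN; ring.
congr (_ * (_ +i* _)%C); rewrite -[RHS]mulN1r -(distrZ _ dT) //; last first.
  exact/(test_functionMr (period_cutoff_test L))/smooth_trig_wave.
by congr (T _); apply/funext => x; rewrite !mulrfctE mulrCA.
Qed.

Lemma distr_lin T (a b : R) phi psi : is_distribution T ->
  test_function phi -> test_function psi ->
  T (fun x => a * phi x + b * psi x) = a * T phi + b * T psi.
Proof.
move=> dT tphi tpsi; rewrite dT.1 ?distrZ //.
rewrite (_ : (fun x => _) = psi * (fun=> b)).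
  exact: test_functionMr (smooth_cst b).
by apply/funext => x; rewrite mulrfctE mulrC.
Qed.

(** Translation by [y] moves both cutoff and wave. The cutoff is moved back by [cutoff_indep]; the
    addition formulas rotate the wave coefficients, and this rotation is multiplication by exp(-i
    phase(y)). *)
Lemma fourier_translate L k T y : 0 < L -> is_distribution T -> distr_periodic L T ->
  fourier L k (translate y T) = fourier L k T * expi (- phase L k y).
Proof.
move=> L0 dT pT; set theta := period_cutoff L.
have tt : test_function theta := period_cutoff_test L.
(* If the cutoff is the default value, both sides are [T] at the zero function. *)
have move_cutoff (a b : R) : T ((fun x => theta (x + y)) * trig_wave L k a b) =
    T (theta * trig_wave L k a b).
  have [ct|t0] := period_cutoffP L; last first.
    by congr (T _); apply/funext => x; rewrite !mulrfctE /theta t0.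
  apply: (@cutoff_indep _ L) => //; first exact: is_period_cutoff_translate.
    exact: smooth_trig_wave.
  by move=> n x; rewrite trig_wave_periodic // gt_eqF.
have tw a b : test_function (theta * trig_wave L k a b).
  exact: (test_functionMr tt (smooth_trig_wave L k a b)).
(* The second basic wave is minus the sine, which accounts for the sign of its coefficient. *)
have tr (a b : R) : translate y T (theta * trig_wave L k a b) =
   (a * cos (phase L k y) + b * sin (phase L k y)) * T (theta * trig_wave L k 1 0)
   + (a * sin (phase L k y) - b * cos (phase L k y))
     * T (theta * trig_wave L k 0 (-1)).
  rewrite -distr_lin //.
  transitivity (T ((fun x => theta (x + y)) * trig_wave L k
     (a * cos (phase L k y) + b * sin (phase L k y))
     (b * cos (phase L k y) - a * sin (phase L k y)))).
    congr (T _); apply/funext => x; rewrite !mulrfctE /trig_wave phaseD cosD sinD.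
    by ring.
  rewrite move_cutoff; congr (T _); apply/funext => x.
  by rewrite !mulrfctE /trig_wave; ring.
rewrite !fourier_trig_wave -mulrA; congr (_ * _).
have mulC (a b c d : R) :
  (a +i* b)%C * (c +i* d)%C = ((a * c - b * d) +i* (a * d + b * c))%C by [].
by rewrite !tr /expi cosN sinN mulC; congr (_ +i* _)%C; rewrite /theta; ring.
Qed.

End Fourier.

(** * Calculus for complex-valued functions of a real variable *)

Section ComplexDerivatives.
Context {R : realType}.
Implicit Types (z w : R -> R[i]) (f : R -> R) (t : R) (c d e : R[i]).

Lemma complex_eqP c d :
  complex.Re c = complex.Re d -> complex.Im c = complex.Im d -> c = d.
Proof. by case: c d => [a b] [a' b'] /= -> ->. Qed.

Lemma is_cderive_cst c t : is_cderive (fun=> c) t 0.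
Proof. by split; exact: is_derive_cst. Qed.

Lemma is_cderive_real f t (d : R) :
  is_derive t (1 : R) f d -> is_cderive (fun s => (f s)%:C%C) t d%:C%C.
Proof. by move=> df; split=> //=; exact: is_derive_cst. Qed.

Lemma is_cderiveD z w t d e :
  is_cderive z t d -> is_cderive w t e -> is_cderive (fun s => z s + w s) t (d + e).
Proof.
have ReD (a b : R[i]) : complex.Re (a + b) = complex.Re a + complex.Re b.
  by case: a b => [? ?] [].
have ImD (a b : R[i]) : complex.Im (a + b) = complex.Im a + complex.Im b.
  by case: a b => [? ?] [].
move=> [dz1 dz2] [dw1 dw2]; split.
  rewrite ReD; under eq_fun do rewrite ReD.
  exact: is_deriveD.
rewrite ImD; under eq_fun do rewrite ImD.
exact: is_deriveD.
Qed.

Lemma is_cderiveZ c z t d :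
  is_cderive z t d -> is_cderive (fun s => c * z s) t (c * d).
Proof.
have ReM (a b : R[i]) : complex.Re (a * b) =
  complex.Re a * complex.Re b - complex.Im a * complex.Im b by case: a b => [? ?] [].
have ImM (a b : R[i]) : complex.Im (a * b) =
  complex.Re a * complex.Im b + complex.Im a * complex.Re b by case: a b => [? ?] [].
move=> [dr di]; split.
  rewrite ReM; under eq_fun do rewrite ReM.
  by apply: is_deriveB; exact: is_deriveZ.
rewrite ImM; under eq_fun do rewrite ImM.
by apply: is_deriveD; exact: is_deriveZ.
Qed.

Lemma is_cderiveB z w t d e :
  is_cderive z t d -> is_cderive w t e -> is_cderive (fun s => z s - w s) t (d - e).
Proof.
move=> dz dw; have := is_cderiveD dz (is_cderiveZ (-1) dw).
by under eq_fun do rewrite mulN1r; rewrite mulN1r.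
Qed.

Lemma is_cderive_conj z t d :
  is_cderive z t d -> is_cderive (fun s => ((z s)^*)%C) t (d^*)%C.
Proof.
have ReJ (a : R[i]) : complex.Re (a^*)%C = complex.Re a by case: a.
have ImJ (a : R[i]) : complex.Im (a^*)%C = - complex.Im a by case: a.
move=> [dr di]; split.
  by rewrite ReJ; under eq_fun do rewrite ReJ.
by rewrite ImJ; under eq_fun do rewrite ImJ; exact: is_deriveN.
Qed.

Lemma is_cderive_sum (I : finType) (z : I -> R -> R[i]) t (d : I -> R[i]) :
  (forall i, is_cderive (z i) t (d i)) ->
  is_cderive (fun s => \sum_i z i s) t (\sum_i d i).
Proof.
move=> dz; elim: (index_enum I) => [|i s IH].
  rewrite big_nil; under eq_fun do rewrite big_nil; exact: is_cderive_cst.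
by rewrite big_cons; under eq_fun do rewrite big_cons; exact: is_cderiveD.
Qed.

Lemma expi0 : expi (0 : R) = 1.
Proof. by rewrite /expi cos0 sin0. Qed.

Lemma expiD (a b : R) : expi (a + b) = expi a * expi b.
Proof.
by rewrite /expi cosD sinD; congr (_ +i* _)%C; rewrite addrC [X in _ + X]mulrC mulrC.
Qed.

Lemma expiN (a : R) : expi (- a) = ((expi a)^*)%C.
Proof. by rewrite /expi cosN sinN. Qed.

Lemma is_cderive_expi (a t : R) :
  is_cderive (fun s => expi (a * s)) t ('i%C * a%:C%C * expi (a * t)).
Proof.
have -> : 'i%C * a%:C%C * expi (a * t) =
    (- (a * sin (a * t)) +i* (a * cos (a * t)))%C.
  by rewrite /expi; simpc.
have da : is_derive t (1 : R) (fun s => a * s) a.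
  by apply: is_derive_eq; rewrite /GRing.scale /=; ring.
split=> /=.
  have := is_derive1_comp (is_derive_cos (a * t)) da.
  by rewrite mulNr mulrC.
have := is_derive1_comp (is_derive_sin (a * t)) da.
by rewrite mulrC.
Qed.

Lemma is_derive_inj (f g d : R -> R) :
  (forall t, is_derive t (1 : R) f (d t)) ->
  (forall t, is_derive t (1 : R) g (d t)) ->
  f 0 = g 0 -> f =1 g.
Proof.
move=> df dg fg0 t; apply/eqP; rewrite -subr_eq0; apply/eqP.
have d0 s : is_derive s (1 : R) (f - g) 0.
  by rewrite -(subrr (d s)); exact: is_deriveB.
have -> : f t - g t = f 0 - g 0 := is_derive_0_is_cst t 0 d0.
by rewrite fg0 subrr.
Qed.

Lemma is_cderive_inj z w (d : R -> R[i]) :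
  (forall t, is_cderive z t (d t)) -> (forall t, is_cderive w t (d t)) ->
  z 0 = w 0 -> z =1 w.
Proof.
move=> dz dw zw0 t; apply: complex_eqP.
  by apply: (is_derive_inj (fun s => (dz s).1) (fun s => (dw s).1)); rewrite zw0.
by apply: (is_derive_inj (fun s => (dz s).2) (fun s => (dw s).2)); rewrite zw0.
Qed.

End ComplexDerivatives.

(** * Algebra of conjugation, circular indices and opposite modes *)

Lemma real_complexM (R : realType) (a b : R) : (a * b)%:C%C = a%:C%C * b%:C%C.
Proof. exact: rmorphM. Qed.

Lemma real_complexN (R : realType) (a : R) : (- a)%:C%C = - a%:C%C.
Proof. exact: rmorphN. Qed.

Lemma conjcM (R : realType) (a b : R[i]) : ((a * b)^*)%C = (a^*)%C * (b^*)%C.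
Proof. exact: rmorphM. Qed.

(** Modulo 3, the indices [alpha], [alpha + 1] and [alpha - 1] exhaust the directions, so the system
    governs every component. *)
Lemma circular_index (alpha i : 'I_3) :
  i = alpha \/ exists2 nu : int, nu = 1 \/ nu = -1 & i = alpha + nu%:~R.
Proof.
have [->|ne] := eqVneq i alpha; first by left.
right; have [->|ne1] := eqVneq i (alpha + 1).
  by exists 1 => //; left.
exists (-1); first by right.
apply/val_inj; move: alpha i ne ne1.
by do 2 ![case=> [[|[|[|//]]] ?]].
Qed.

Lemma addr_sign_neq (alpha : 'I_3) (nu : int) :
  nu = 1 \/ nu = -1 -> (alpha + nu%:~R == alpha) = false.
Proof. by rewrite -[X in _ == X]addr0 (inj_eq (addrI alpha)); case=> ->. Qed.

Lemma mode_oppK (K : nat) : involutive (@mode_opp K).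
Proof. by move=> k; apply/ffunP => i; rewrite !ffunE rev_ordK. Qed.

Lemma conjcN (R : realType) (a : R[i]) : ((- a)^*)%C = - (a^*)%C.
Proof. exact: rmorphN. Qed.

Lemma conjcB (R : realType) (a b : R[i]) : ((a - b)^*)%C = (a^*)%C - (b^*)%C.
Proof. exact: rmorphB. Qed.

(** * The explicit solution of the kinetic step *)

Section KineticStep.
Context {R : realType} (L : R) (K N : nat) (q m : 'I_N -> R).
Context (S : ('rV[R]_3 -> R) -> R) (gamma : mode K -> R[i]) (alpha : 'I_3).
Context (U0 : state R K N).
Hypotheses (L_gt0 : 0 < L) (S_distr : is_distribution S) (S_per : distr_periodic L S).
Hypotheses (gamma_herm : hermitian_coef gamma) (U0_real : real_fields U0).

Let Pi := gempif_coupling L gamma.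

Let line (p : 'I_N) (t : R) : 'rV[R]_3 :=
  pos U0 p + (t * vel U0 p 0 alpha) *: basis_vec alpha.

(** For nonzero [t], this is the time average over the step of the velocity times the coupling
    coefficient along the trajectory. *)
Let wave (p : 'I_N) (k : mode K) (t : R) : R[i] :=
  gamma k * fourier L (freq k) S * Vhat L alpha t U0 p k.

(* [Vhat] has a junk value at time 0 when [k_alpha != 0], since there it inverts
   zero; the factor [s] cancels it. *)
Lemma is_cderive_Vhat p k t :
  is_cderive (fun s => s%:C%C * Vhat L alpha s U0 p k) t
    ((vel U0 p 0 alpha)%:C%C * expi (- phase L (freq k) (line p t))).
Proof.
set v := vel U0 p 0 alpha; set om : R := 2 * pi * (freq k 0 alpha)%:~R / L.
set e0 := expi (- phase L (freq k) (pos U0 p)).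
have -> : expi (- phase L (freq k) (line p t)) = expi (- (om * v) * t) * e0.
  (* Only the component [alpha] of the position moves, so the phase varies at the constant rate
     [om * v]. *)
  rewrite /line phaseD phaseZ phase_basis -expiD; congr expi.
  by rewrite /om /v; ring.
have [k0|k0] := eqVneq (freq k 0 alpha) 0.
  rewrite (_ : (fun s => _) = fun s => v%:C%C * e0 * s%:C%C); last first.
    by apply/funext => s; rewrite /Vhat k0 eqxx mulrC.
  rewrite /om k0 mulr0 mul0r mul0r oppr0 mul0r expi0 mul1r.
  rewrite -[X in is_cderive _ _ X]mulr1.
  apply: is_cderiveZ; exact: (@is_cderive_real _ id _ _ (is_derive_id _ _)).
have om0 : om != 0.
  by rewrite /om !mulf_neq0 ?invr_eq0 ?intr_eq0 ?pnatr_eq0 // gt_eqF // pi_gt0.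
have iom0 : 'i%C * om%:C%C != 0 :> R[i].
  by apply: mulf_neq0; rewrite eq_complex /= ?oner_eq0 ?andbF ?(negbTE om0).
rewrite (_ : (fun s => _) =
    fun s => (- ('i%C * om%:C%C))^-1 * e0 * (expi (- (om * v) * s) - 1)); last first.
  apply/funext => s; rewrite /Vhat (negbTE k0).
  have -> : 2 * pi * (freq k 0 alpha)%:~R * s / L = om * s.
    by rewrite /om; ring.
  have -> : - (2 * pi * (freq k 0 alpha)%:~R * s * v / L) = - (om * v) * s.
    by rewrite /om; ring.
  (* At [s = 0] the left side vanishes by its factor [s], the right side because exp(0) - 1 = 0. *)
  have [->|s0] := eqVneq s 0; first by rewrite mul0r mulr0 expi0 subrr mulr0.
  have sC : s%:C%C != 0 :> R[i] by rewrite eq_complex /= (negbTE s0).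
  rewrite -/e0 real_complexM mulrA; move: ('i%C * om%:C%C) iom0 => z z0.
  by field; rewrite z0 sC.
have := is_cderiveZ ((- ('i%C * om%:C%C))^-1 * e0)
  (is_cderiveB (is_cderive_expi (- (om * v)) t) (is_cderive_cst 1 t)).
congr (is_cderive _ _ _); rewrite subr0 real_complexN real_complexM.
rewrite mulrN ['i%C * (_ * _)]mulrA.
by move: ('i%C * om%:C%C) iom0 => z z0; field.
Qed.

(** By [fourier_translate], moving the shape along the line only multiplies its coefficient by the
    exponential already integrated in [is_cderive_Vhat]. *)
Lemma is_cderive_wave p k t :
  is_cderive (fun s => s%:C%C * wave p k s) t
    ((vel U0 p 0 alpha)%:C%C * Pi alpha (translate (line p t) S) k).
Proof.
rewrite /Pi /gempif_coupling fourier_translate //.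
have := is_cderiveZ (gamma k * fourier L (freq k) S) (is_cderive_Vhat p k t).
congr (is_cderive _ _ _); last by ring.
by apply/funext => s; rewrite /wave; ring.
Qed.

(** Each factor is Hermitian: [gamma] by hypothesis, the Fourier coefficient because [S] is real,
    and [Vhat] because negating [k] conjugates its exponentials and its imaginary denominator. *)
Lemma hermitian_wave p t : hermitian_coef (fun k => wave p k t).
Proof.
move=> k; rewrite /wave (conjcM (_ * _)) (conjcM (gamma _)) [gamma k]gamma_herm.
congr (_ * _ * _).
  by rewrite freq_opp fourier_opp // conjcK.
have fo : freq (mode_opp k) 0 alpha = - freq k 0 alpha by rewrite freq_opp mxE.
rewrite /Vhat fo freq_opp phaseN oppr_eq0.
case: ifP => _; rewrite !conjcM !expiN ?conjcK ?conjc_real //.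
congr (_ * _ * _).
  rewrite conjc_inv conjcN conjcM conjc_real; congr (_ ^-1); congr (- _).
  rewrite mulrNz mulrN !mulNr real_complexN mulrN -mulNr; congr (_ * _).
  by apply: complex_eqP; rewrite /= ?oppr0 ?opprK.
by rewrite conjcB conjcK conjc1 -expiN mulrNz mulrN !mulNr.
Qed.

Let efield_exact k t : R[i] :=
  Efield U0 alpha k - t%:C%C * gamma k * fourier L (freq k) S
    * \sum_(p < N) (q p)%:C%C * Vhat L alpha t U0 p k.

Lemma is_cderive_efield k t :
  is_cderive (efield_exact k) t
    (- \sum_(p < N) (q p * vel U0 p 0 alpha)%:C%C
         * Pi alpha (translate (line p t) S) k).
Proof.
rewrite -sub0r (_ : efield_exact k = fun s => Efield U0 alpha k
  - \sum_p (q p)%:C%C * (s%:C%C * wave p k s)); last first.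
  apply/funext => s; rewrite /efield_exact mulr_sumr; congr (_ - _).
  by apply: eq_bigr => p _; rewrite /wave; ring.
apply: is_cderiveB; first exact: is_cderive_cst.
apply: is_cderive_sum => p; rewrite rmorphM -mulrA.
exact/is_cderiveZ/is_cderive_wave.
Qed.

(** The amount subtracted from the transverse velocity, kept complex to match the form of the
    equation. *)
Let kick (nu : int) p t : R[i] :=
  (nu%:~R * t * (q p / m p) * L ^+ 3)%:C%C *
    \sum_(k : mode K) Bfield U0 (alpha - nu%:~R) k * ((wave p k t)^*)%C.

Lemma is_cderive_kick nu p t : is_cderive (kick nu p) t
  ((nu%:~R * (q p / m p) * L ^+ 3)%:C%C *
    \sum_(k : mode K) (vel U0 p 0 alpha)%:C%C * Bfield U0 (alpha - nu%:~R) k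
       * ((Pi (alpha - nu%:~R) (translate (line p t) S) k)^*)%C).
Proof.
(* The time factor is real, so it passes under the conjugation and joins [wave], where the
   derivative is known. *)
rewrite (_ : kick nu p = fun s => (nu%:~R * (q p / m p) * L ^+ 3)%:C%C *
    \sum_(k : mode K) Bfield U0 (alpha - nu%:~R) k * ((s%:C%C * wave p k s)^*)%C).
  apply/is_cderiveZ/is_cderive_sum => k.
  rewrite -mulrA mulrCA; apply: is_cderiveZ.
  have := is_cderive_conj (is_cderive_wave p k t).
  by congr (is_cderive _ _ _); rewrite conjcM conjc_real.
apply/funext => s; rewrite /kick [nu%:~R * s]mulrC -!mulrA real_complexM -mulrA.
rewrite mulrCA mulr_sumr; congr (_ * _); apply: eq_bigr => k _.
by rewrite conjcM conjc_real mulrCA.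
Qed.

(** Conjugation amounts to exchanging [k] and [-k] in the sum, since the magnetic coefficients and
    [wave] are both Hermitian. *)
Lemma kick_real nu p t : (complex.Re (kick nu p t))%:C%C = kick nu p t.
Proof.
apply: RRe_real; apply/complex_realP.
have kJ : ((kick nu p t)^*)%C = kick nu p t.
  rewrite /kick conjcM conjc_real; congr (_ * _).
  rewrite rmorph_sum (reindex_inj (inv_inj (@mode_oppK K))).
  apply: eq_bigr => k _.
  by rewrite /= conjcM conjcK -(U0_real _).2 [wave p k t]hermitian_wave conjcK.
exists (complex.Re (kick nu p t)); move: kJ; case: (kick nu p t) => a b [] /=.
by move=> /eqP; rewrite -subr_eq0 -opprD oppr_eq0 -mulr2n mulrn_eq0 => /eqP ->.
Qed.

(* The sign [nu] such that [i = alpha + nu], for [i != alpha]. *)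
Let sgn (i : 'I_3) : int := if i == alpha + 1 then 1 else -1.

Lemma sgnE nu : nu = 1 \/ nu = -1 -> sgn (alpha + nu%:~R) = nu.
Proof. by rewrite /sgn (inj_eq (addrI alpha)); case=> ->. Qed.

(** Velocities are real by type, so the real part of [kick] is stored; [kick_real] ensures that
    nothing is lost. The factor [(i != alpha)%:R] removes the kick in direction [alpha], where [sgn]
    has no meaning. *)
Let flow (t : R) : state R K N := State (fun p => line p t)
  (fun p => \row_i (vel U0 p 0 i - (i != alpha)%:R * complex.Re (kick (sgn i) p t)))
  (fun i k => if i == alpha then efield_exact k t else Efield U0 i k)
  (Bfield U0).

Lemma line0 p : line p 0 = pos U0 p.
Proof. by rewrite /line mul0r scale0r addr0. Qed.

Lemma line_alpha p t : line p t 0 alpha = pos U0 p 0 alpha + t * vel U0 p 0 alpha.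
Proof. by rewrite !mxE !eqxx mulr1. Qed.

Lemma line_trans p t nu : nu = 1 \/ nu = -1 ->
  line p t 0 (alpha + nu%:~R) = pos U0 p 0 (alpha + nu%:~R).
Proof. by move=> hnu; rewrite !mxE eqxx addr_sign_neq // mulr0 addr0. Qed.

Lemma efield_exact0 k : efield_exact k 0 = Efield U0 alpha k.
Proof. by rewrite /efield_exact -!mulrA mul0r subr0. Qed.

Lemma kick0 nu p : kick nu p 0 = 0.
Proof. by rewrite /kick mulr0 !mul0r. Qed.

Lemma flow0 : flow 0 = U0.
Proof.
transitivity (State (pos U0) (vel U0) (Efield U0) (Bfield U0)); last by case: (U0).
congr State.
- by apply/funext => p; rewrite line0.
- by apply/funext => p; apply/rowP => i; rewrite mxE kick0 mulr0 subr0.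
- apply/funext => i; apply/funext => k.
  by case: eqP => // ->; rewrite efield_exact0.
Qed.

(** The increment of the electric field is a combination of the functions [wave] with real
    coefficients, hence Hermitian. *)
Lemma flow_real t : real_fields (flow t).
Proof.
move=> i; split=> [k|]; last exact: (U0_real i).2.
rewrite /=; case: eqP => _; last exact: (U0_real i).1.
rewrite /efield_exact conjcB -(U0_real _).1; congr (_ - _).
have E k' p : t%:C%C * gamma k' * fourier L (freq k') S *
    ((q p)%:C%C * Vhat L alpha t U0 p k') = (t * q p)%:C%C * wave p k' t.
  by rewrite real_complexM /wave; ring.
rewrite !mulr_sumr rmorph_sum; apply: eq_bigr => p _.
by rewrite !E [wave p k t]hermitian_wave [RHS]conjcM conjc_real.
Qed.

Lemma flow_ode t : kinetic_ode L q m S Pi Pi alpha flow t.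
Proof.
have velE p s : vel (flow s) p 0 alpha = vel U0 p 0 alpha.
  by rewrite mxE eqxx mul0r subr0.
split.
- move=> p; rewrite velE; under eq_fun do rewrite line_alpha.
  by apply: is_derive_eq; rewrite /GRing.scale /=; ring.
- move=> p nu hnu; under eq_fun do rewrite line_trans //.
  exact: is_derive_cst.
- by move=> p; under eq_fun do rewrite velE; exact: is_derive_cst.
- move=> p nu hnu; rewrite mulNr -[X in is_cderive _ _ X]sub0r velE.
  rewrite (_ : (fun s => _) =
      fun s => (vel U0 p 0 (alpha + nu%:~R))%:C%C - kick nu p s).
    apply: is_cderiveB; first exact: is_cderive_cst.
    exact: is_cderive_kick.
  (* In a transverse direction [sgn] recovers [nu], and the stored real part is the full complex
     kick. *)
  apply/funext => s; rewrite mxE addr_sign_neq // mul1r sgnE //.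
  by rewrite -kick_real rmorphB.
- move=> k; rewrite /= eqxx; under eq_bigr do rewrite velE.
  exact: is_cderive_efield.
- by move=> k nu hnu; rewrite /= addr_sign_neq //; exact: is_cderive_cst.
- by move=> i k; exact: is_cderive_cst.
Qed.

(** * Uniqueness: frozen quantities and trajectories first, then the quantities they drive *)

Section Uniqueness.
Variable U : R -> state R K N.
Hypotheses (U_init : U 0 = U0) (U_ode : forall t, kinetic_ode L q m S Pi Pi alpha U t).

Lemma solution_vel p t : vel (U t) p 0 alpha = vel U0 p 0 alpha.
Proof.
rewrite -U_init.
exact: (is_derive_0_is_cst t 0 (fun s => ode_vel (U_ode s) p)).
Qed.

Lemma solution_pos p t : pos (U t) p = line p t.
Proof.
apply/rowP => i; case: (circular_index alpha i) => [->|[nu hnu ->]].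
  (* Constancy of the velocity lets the affine function [x] be seen as having the very derivative
     prescribed by the system. *)
  rewrite line_alpha; pose x s := pos U0 p 0 alpha + s * vel U0 p 0 alpha.
  have dx s : is_derive s (1 : R) x (vel (U s) p 0 alpha).
    rewrite solution_vel.
    by apply: is_derive_eq; rewrite /GRing.scale /=; ring.
  apply: (is_derive_inj (fun s => ode_pos (U_ode s) p) dx).
  by rewrite U_init /x mul0r addr0.
rewrite line_trans // -[in RHS]U_init.
exact: (is_derive_0_is_cst t 0 (fun s => ode_pos_trans (U_ode s) p hnu)).
Qed.

Lemma solution_B i k t : Bfield (U t) i k = Bfield U0 i k.
Proof.
rewrite -U_init.
by apply: (is_cderive_inj (fun s => ode_B (U_ode s) i k) (is_cderive_cst _)).
Qed.

Lemma solution_E_trans k t nu : nu = 1 \/ nu = -1 ->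
  Efield (U t) (alpha + nu%:~R) k = Efield U0 (alpha + nu%:~R) k.
Proof.
move=> hnu; rewrite -U_init.
by apply: (is_cderive_inj (fun s => ode_E_trans (U_ode s) k hnu) (is_cderive_cst _)).
Qed.

(** Substituting the known velocity and trajectory makes the right-hand side an explicit function of
    time, with [efield_exact] as antiderivative. *)
Lemma solution_E k t : Efield (U t) alpha k = efield_exact k t.
Proof.
apply: (is_cderive_inj (fun s => ode_E (U_ode s) k)); last first.
  by rewrite U_init efield_exact0.
move=> s; under eq_bigr do rewrite solution_vel solution_pos.
exact: is_cderive_efield.
Qed.

(** The magnetic field, the velocity along [alpha] and the trajectory are already determined, so the
    force is an explicit function of time whose antiderivative is minus [kick]. *)
Lemma solution_vel_trans p t nu : nu = 1 \/ nu = -1 ->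
  (vel (U t) p 0 (alpha + nu%:~R))%:C%C =
  (vel U0 p 0 (alpha + nu%:~R))%:C%C - kick nu p t.
Proof.
move=> hnu; pose v s := (vel U0 p 0 (alpha + nu%:~R))%:C%C - kick nu p s.
apply: (@is_cderive_inj _ _ v _ (fun s => ode_vel_trans (U_ode s) p hnu)); last first.
  by rewrite U_init /v kick0 subr0.
move=> s; rewrite solution_pos mulNr -[X in is_cderive _ _ X]sub0r.
under eq_bigr do rewrite solution_B solution_vel.
by apply: is_cderiveB; [exact: is_cderive_cst | exact: is_cderive_kick].
Qed.

End Uniqueness.

Lemma kinetic_flow_exists tau : exists U1, kinetic_flow L q m S Pi Pi alpha tau U0 U1.
Proof.
by exists (flow tau), flow; split=> //; [exact: flow0|exact: flow_real|exact: flow_ode].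
Qed.

End KineticStep.

Theorem lemma3 (R : realType) (L : R) (K N : nat) (q m : 'I_N -> R)
    (S : ('rV[R]_3 -> R) -> R) (gamma : mode K -> R[i])
    (alpha : 'I_3) (U0 : state R K N) (tau : R)
    (L_gt0 : 0 < L) (N_gt0 : (0 < N)%N) (m_gt0 : forall p, 0 < m p)
    (S_distr : is_distribution S) (S_per : distr_periodic L S)
    (gamma_herm : hermitian_coef gamma)
    (U0_real : real_fields U0) (tau_neq0 : tau != 0) :
  let Pi1 := gempif_coupling L gamma in
  let Pi2 := gempif_coupling L gamma in
  (exists U1 : state R K N, kinetic_flow L q m S Pi1 Pi2 alpha tau U0 U1) /\
  (forall U1 : state R K N, kinetic_flow L q m S Pi1 Pi2 alpha tau U0 U1 ->
    (forall p, pos U1 p 0 alpha = pos U0 p 0 alpha + tau * vel U0 p 0 alpha) /\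
    (forall p (nu : int), nu = 1 \/ nu = -1 ->
       pos U1 p 0 (alpha + nu%:~R) = pos U0 p 0 (alpha + nu%:~R)) /\
    (forall p, vel U1 p 0 alpha = vel U0 p 0 alpha) /\
    (forall p (nu : int), nu = 1 \/ nu = -1 ->
       (vel U1 p 0 (alpha + nu%:~R))%:C%C
       = (vel U0 p 0 (alpha + nu%:~R))%:C%C
         - (nu%:~R * tau * (q p / m p) * L ^+ 3)%:C%C
           * \sum_(k : mode K) Bfield U0 (alpha - nu%:~R) k
               * ((gamma k * fourier L (freq k) S * Vhat L alpha tau U0 p k)^*)%C) /\
    (forall k, Efield U1 alpha k
       = Efield U0 alpha k
         - tau%:C%C * gamma k * fourier L (freq k) S
           * \sum_(p < N) (q p)%:C%C * Vhat L alpha tau U0 p k) /\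
    (forall k (nu : int), nu = 1 \/ nu = -1 ->
       Efield U1 (alpha + nu%:~R) k = Efield U0 (alpha + nu%:~R) k) /\
    (forall i k, Bfield U1 i k = Bfield U0 i k) /\
    (forall i x, trig_field L (Bfield U1 i) x = trig_field L (Bfield U0 i) x)).
Proof.
move=> Pi1 Pi2; split; first exact: kinetic_flow_exists.
(* The final state becomes [U tau], so each claim is the value at [tau] of a formula valid at all
   times. *)
move=> _ [U [U_init _ U_ode <-]].
split=> [p|]; first by rewrite (solution_pos U_init U_ode) line_alpha.
split=> [p nu hnu|]; first by rewrite (solution_pos U_init U_ode) line_trans.
split=> [p|]; first exact: (solution_vel U_init U_ode).
split=> [p nu hnu|].
  exact: (solution_vel_trans L_gt0 S_distr S_per U_init U_ode).
split=> [k|]; first exact: (solution_E L_gt0 S_distr S_per U_init U_ode).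
split=> [k nu hnu|]; first exact: (solution_E_trans U_init U_ode).
split=> [i k|i x]; first exact: (solution_B U_init U_ode).
by apply: eq_bigr => k _; rewrite (solution_B U_init U_ode).
Qed.
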